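(* Let $k$ be a positive integer. If $G$ is an induced $K_{1,k}$-free graph (no induced subgraph of $G$ is isomorphic to the star $K_{1,k}$) with minimum degree $\delta(G)\ge 1$, then $\mathrm{a}_1'(G)\le k-1$. In particular, if $G$ is a claw-free graph (i.e. induced $K_{1,3}$-free) with $\delta(G)\ge 1$, then $\mathrm{a}_1'(G)\le 2$.
   Context: Graphs are finite, simple and undirected, with at least one vertex. For positive integers $a,b$, the $(a,b)$-biased Maker-Breaker domination game on a graph $G$ is played by Dominator and Staller, who move alternately; on each move Dominator selects $a$ unplayed vertices and Staller selects $b$ unplayed vertices (if fewer unplayed vertices remain than the player's bias, the player selects all remaining ones). Dominator wins if the vertices he selected during the game form a dominating set of $G$; otherwise Staller wins, equivalently, Staller wins iff she claims all vertices of the closed neighborhood of some vertex. In the S-game Staller moves first, and $\mathrm{a}'_\ell(G)$ is the minimum positive integer $a$ such that Dominator wins the $(a,\ell)$-biased S-game on $G$ under optimal play ($\infty$ if no such $a$ exists). *)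

(* Defs.v *)
(* MathComp; boolp supplies classical case analysis. *)
From HB Require Import structures.
From mathcomp Require Import all_boot.
From mathcomp Require Import boolp.
Set Implicit Arguments.
Unset Strict Implicit.
Unset Printing Implicit Defensive.

Record sgraph := SGraph {
  vert :> finType;
  adj : rel vert;
  adj_sym : symmetric adj;
  adj_irr : irreflexive adj;
  vert_gt0 : 0 < #|vert| }.

Definition degree (G : sgraph) (v : G) : nat := #|[set u | adj v u]|.

(* The default value #|G| of the minimum is larger than every degree, hence
   never attained: G has a vertex and no loops. *)
Definition min_degree (G : sgraph) : nat :=
  \big[minn/#|vert G|]_(v : G) degree v.

Definition dominating (G : sgraph) (D : {set G}) : bool :=
  [forall v, exists u in D, (u == v) || adj u v].

Section Induced.
Variables (G : sgraph) (A : {set G}) (A0 : 0 < #|A|).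

Definition induced_adj : rel {x : G | x \in A} :=
  fun x y => adj (val x) (val y).

Lemma induced_sym : symmetric induced_adj.
Proof. by move=> x y; apply: adj_sym. Qed.

Lemma induced_irr : irreflexive induced_adj.
Proof. by move=> x; apply: adj_irr. Qed.

Lemma induced_gt0 : 0 < #|{: {x : G | x \in A}}|.
Proof. by rewrite card_sig. Qed.

Definition induced : sgraph := SGraph induced_sym induced_irr induced_gt0.

End Induced.

Definition isomorphic (G H : sgraph) : Prop :=
  exists2 f : G -> H, bijective f & forall x y, adj (f x) (f y) = adj x y.

Section Star.
Variable k : nat.

(* K_{1,k}: None is the centre, the Some i are the k leaves. *)
Definition star_adj : rel (option 'I_k) :=
  fun x y => (x == None) != (y == None).

Lemma star_sym : symmetric star_adj.
Proof. by move=> x y; rewrite /star_adj eq_sym. Qed.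

Lemma star_irr : irreflexive star_adj.
Proof. by move=> x; rewrite /star_adj eqxx. Qed.

Lemma star_gt0 : 0 < #|{: option 'I_k}|.
Proof. by apply/card_gt0P; exists None. Qed.

Definition star : sgraph := SGraph star_sym star_irr star_gt0.

End Star.

Definition induced_free (H G : sgraph) : Prop :=
  forall (A : {set G}) (A0 : 0 < #|A|),
    ~ isomorphic (induced A0) H.

Definition claw_free (G : sgraph) : Prop := induced_free (star 3) G.

Inductive player := Dominator | Staller.

Section Game.
Variables (G : sgraph) (a b : nat).
Implicit Types D S X : {set G}.

Definition unplayed D S : {set G} := ~: (D :|: S).

Definition legal (bias : nat) D S X : bool :=
  (X \subset unplayed D S) && (#|X| == minn bias #|unplayed D S|).

(* Dominator, of bias a, can force a win from the position in which he has
   selected D, Staller (of bias b) has selected S, and the given player is to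
   move. *)
Inductive dom_wins : player -> {set G} -> {set G} -> Prop :=
| DomWinsEnd p D S :
    unplayed D S = set0 -> dominating D -> dom_wins p D S
| DomWinsDominator D S X :
    unplayed D S != set0 -> legal a D S X ->
    dom_wins Staller (D :|: X) S -> dom_wins Dominator D S
| DomWinsStaller D S :
    unplayed D S != set0 ->
    (forall X, legal b D S X -> dom_wins Dominator D (S :|: X)) ->
    dom_wins Staller D S.

Definition dom_wins_Sgame : Prop := dom_wins Staller set0 set0.

End Game.

(* Extended naturals: None is infinity. *)
Definition enat_le (x y : option nat) : bool :=
  match x, y with
  | _, None => true
  | None, Some _ => false
  | Some m, Some n => m <= n
  end.

(* a'_l(G). *)
Definition Sgame_threshold (l : nat) (G : sgraph) : option nat :=
  match pselect (exists a, (0 < a) && `[< dom_wins_Sgame G a l >]) with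
  | left ex_a => Some (ex_minn ex_a)
  | right _ => None
  end.

(* Main.v *)
Require Import Defs.
From mathcomp Require Import all_boot.
From mathcomp Require Import boolp.
Set Implicit Arguments.
Unset Strict Implicit.
Unset Printing Implicit Defensive.

(** If [F] is a spanning subgraph of [G] without isolated vertices and with
    maximum degree at most [a], then Dominator wins with bias [a] by answering
    each Staller vertex [v] with all of [N_F(v)]: Staller's vertices stay
    [F]-independent and all their [F]-neighbours belong to Dominator.  For
    [k >= 3] such an [F] with [a = k - 1] is one with fewest edges: if [v] has
    [k] neighbours in [F], two of them, [x] and [y], are adjacent in [G], and
    replacing [vx], [vy] by [xy] saves an edge.  For [k = 2] (where a triangle
    has no such [F]) [G] is a disjoint union of cliques, and Dominator only
    needs one vertex in each clique touched by Staller. *)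

(** Serves to pad a planned reply, possibly too small, to the exact size that [legal] demands. *)
Lemma exists_set_between (T : finType) (A B : {set T}) (m : nat) :
    A \subset B -> #|A| <= m -> m <= #|B| ->
  exists X : {set T}, [/\ A \subset X, X \subset B & #|X| = m].
Proof.
move=> sAB leAm lemB.
have /card_geqP[s [uniq_s size_s sub_s]] : m - #|A| <= #|B :\: A|.
  by rewrite cardsD (setIidPr sAB) leq_sub2r.
exists (A :|: [set x in s]); split; first exact: subsetUl.
  rewrite subUset sAB; apply/subsetP=> x; rewrite inE => /sub_s.
  by rewrite inE => /andP[].
rewrite cardsU (_ : A :&: _ = set0) ?cards0 ?subn0; last first.
  apply/setP=> x; rewrite !inE; apply/negP=> /andP[xA /sub_s].
  by rewrite inE xA.
by rewrite cardsE (card_uniqP uniq_s) size_s subnKC.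
Qed.

Lemma min_degree_le (G : sgraph) (v : G) : min_degree G <= degree v.
Proof.
rewrite /min_degree; elim: (index_enum _) (mem_index_enum v) => //= u s IH.
rewrite inE big_cons geq_min; case: eqP => [<-|_ /=]; first by rewrite leqnn.
by move/IH ->; rewrite orbT.
Qed.

Lemma has_neighbour (G : sgraph) (v : G) :
  0 < min_degree G -> exists u, adj v u.
Proof.
move=> /leq_trans/(_ (min_degree_le v))/card_gt0P[u].
by rewrite inE; exists u.
Qed.

Lemma Sgame_threshold_le (G : sgraph) (a b : nat) :
  0 < a -> dom_wins_Sgame G a b -> enat_le (Sgame_threshold b G) (Some a).
Proof.
move=> a_gt0 win; rewrite /Sgame_threshold; case: pselect => [ex_a | []] /=.
  by case: ex_minnP => m _; apply; rewrite a_gt0; apply/asboolP.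
by exists a; rewrite a_gt0; apply/asboolP.
Qed.

(** Otherwise [k] members of [A] would be pairwise non-adjacent and, together with [v], would induce
    a [K_{1,k}] centred at [v]. *)
Lemma induced_star_free_adj (G : sgraph) (k : nat) (v : G) (A : {set G}) :
    induced_free (star k) G -> A \subset [set u | adj v u] -> k <= #|A| ->
  exists x y, [/\ x \in A, y \in A, x != y & adj x y].
Proof.
move=> free sA /card_geqP[s [uniq_s size_s sub_s]].
have adj_s x : x \in s -> adj v x.
  by move=> /sub_s /(subsetP sA); rewrite inE.
case: (pselect (exists x y, [/\ x \in s, y \in s, x != y & adj x y])).
  by move=> [x [y [/sub_s xA /sub_s yA neq xy]]]; exists x, y.
move=> indep; exfalso.
have adj_ss x y : x \in s -> y \in s -> adj x y = false.
  move=> xs ys; have [->|neq] := eqVneq x y; first exact: adj_irr.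
  by apply/negP=> xy; apply: indep; exists x, y.
have v_s : v \notin s by apply/negP=> /adj_s; rewrite adj_irr.
pose B := [set x in v :: s].
have B0 : 0 < #|B| by apply/card_gt0P; exists v; rewrite !inE eqxx.
apply: (free B B0).
(* [insub] lands in an option whose [None] is the centre; [fE] rules this value out for the leaves
   by bounding the index below [k]. *)
pose f (x : induced B0) : star k :=
  if val x == v then None else insub (index (val x) s).
have in_s (x : induced B0) : val x != v -> val x \in s.
  by have := valP x; rewrite !inE => /orP[->|].
have fE (x : induced B0) : val x != v ->
    exists2 i : 'I_k, f x = Some i & i = index (val x) s :> nat.
  move=> xv; rewrite /f (negPf xv).
  have lt : index (val x) s < k by rewrite -size_s index_mem in_s.
  by rewrite (insubT (fun i => i < k) lt); exists (Ordinal lt).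
exists f.
  apply: inj_card_bij => [x y|].
    have [xv|xv] := eqVneq (val x) v; have [yv|yv] := eqVneq (val y) v.
    - by move=> _; apply: val_inj; rewrite xv yv.
    - by have [i ->] := fE y yv; rewrite /f xv eqxx.
    - by have [i ->] := fE x xv; rewrite /f yv eqxx.
    have [i -> ix] := fE x xv; have [j -> jy] := fE y yv.
    move=> [ij]; apply: val_inj.
    by apply: (@index_inj _ v s); rewrite ?in_s // -ix -jy ij.
  rewrite card_option card_ord card_sig cardsE.
  by rewrite (card_uniqP _) /= ?v_s ?uniq_s ?size_s.
move=> x y; rewrite /= /star_adj /induced_adj.
have [xv|xv] := eqVneq (val x) v; have [yv|yv] := eqVneq (val y) v.
- by rewrite /f xv yv eqxx adj_irr.
- have [i -> _] := fE y yv; rewrite /f xv eqxx.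
  by rewrite adj_s ?in_s.
- have [i -> _] := fE x xv; rewrite /f yv eqxx.
  by rewrite adj_sym adj_s ?in_s.
have [i -> _] := fE x xv; have [j -> _] := fE y yv.
by rewrite adj_ss ?in_s.
Qed.

(** [Inv] describes the positions with Staller to move, and [R] is the planned reply to [v]. It may
    overlap [D] or be smaller than the bias, since monotonicity makes surplus Dominator vertices
    harmless. On a full board each vertex lies in [D] or is Staller's, hence has a neighbour in
    [D]. *)
Lemma dom_wins_of_invariant (G : sgraph) (a : nat)
    (Inv : {set G} -> {set G} -> Prop) :
    (forall D D' S : {set G}, D \subset D' -> Inv D S -> Inv D' S) ->
    (forall (D S : {set G}) v, Inv D S -> v \in S ->
       exists2 u, u \in D & adj u v) ->
    (forall (D S : {set G}) v, Inv D S -> v \in unplayed D S ->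
       exists R : {set G}, [/\ #|R| <= a, R \subset ~: (S :|: [set v])
                             & Inv (D :|: R) (S :|: [set v])]) ->
    0 < a -> Inv set0 set0 -> dom_wins_Sgame G a 1.
Proof.
move=> mono nbr step a_gt0; rewrite /dom_wins_Sgame.
have over p D S : unplayed D S = set0 -> Inv D S -> dom_wins a 1 p D S.
  move=> U0 inv; apply: DomWinsEnd => //.
  apply/forallP=> v; apply/exists_inP.
  have /setP/(_ v) := U0; rewrite !inE => /negbFE/orP[vD|vS].
    by exists v; rewrite ?eqxx.
  by have [u uD uv] := nbr _ _ _ inv vS; exists u; rewrite ?uv ?orbT.
(* The two empty sets become independent variables, for induction on the number of unplayed
   vertices. *)
move: set0 {2 4}set0 => D S; have [n] := ubnP #|unplayed D S|.
elim: n D S => // n IH D S ltn inv.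
have [U0|U_neq0] := eqVneq (unplayed D S) set0; first exact: over.
apply: DomWinsStaller => // X /andP[sXU /eqP cardX].
have /eqP/cards1P[v Xv] : #|X| = 1.
  by rewrite cardX; apply/minn_idPl; rewrite card_gt0.
have vU : v \in unplayed D S by rewrite (subsetP sXU) // Xv set11.
rewrite {X}Xv in sXU cardX *; have [R [leR sR invR]] := step _ _ _ inv vU.
set S' := S :|: _ in sR invR *.
have sRU : R :\: D \subset unplayed D S'.
  apply/subsetP=> x; rewrite !inE => /andP[xD /(subsetP sR)].
  by rewrite !inE (negPf xD).
(* Staller may have taken the last vertex. Then [R] already lies in [D], so the invariant holds
   without a reply. *)
have [U0|U'_neq0] := eqVneq (unplayed D S') set0.
  apply: over => //; move: sRU; rewrite U0 subset0 setD_eq0 => /setUidPl DR.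
  by rewrite -DR.
have [||Y [sRY sYU cardY]] :=
  @exists_set_between _ _ _ (minn a #|unplayed D S'|) sRU.
- rewrite leq_min subset_leq_card // andbT.
  exact: leq_trans (subset_leq_card (subsetDl _ _)) leR.
- exact: geq_minr.
apply: (@DomWinsDominator _ _ _ _ _ Y) => //.
  by rewrite /legal sYU cardY /=.
apply: IH; last first.
  apply: mono invR; rewrite subUset subsetUl /=; apply/subsetP=> x xR.
  rewrite inE; case: (boolP (x \in D)) => //= xD.
  by rewrite (subsetP sRY) // inE xD.
rewrite -ltnS; apply: leq_trans ltn; rewrite ltnS; apply: proper_card.
apply/properP; split.
  apply/subsetP=> x; rewrite !inE !negb_or.
  by case/andP=> /andP[-> _] /andP[-> _].
by exists v => //; rewrite !inE eqxx !orbT.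
Qed.

Definition nbrs (T : finType) (F : {set T * T}) (v : T) : {set T} :=
  [set u | (v, u) \in F].

(* An undirected spanning subgraph is encoded as a symmetric set of ordered
   pairs, so that each edge contributes two elements. *)
Definition edge_cover (G : sgraph) (F : {set G * G}) : Prop :=
  [/\ forall x y, (x, y) \in F -> adj x y,
      forall x y, (x, y) \in F -> (y, x) \in F
    & forall v, exists u, (v, u) \in F].

Lemma dom_wins_of_edge_cover (G : sgraph) (F : {set G * G}) (a : nat) :
    edge_cover F -> (forall v, #|nbrs F v| <= a) -> 0 < a ->
  dom_wins_Sgame G a 1.
Proof.
move=> [Fadj Fsym Fcov] Fdeg a_gt0.
pose Inv (D S : {set G}) := forall v, v \in S -> nbrs F v \subset D.
apply: (@dom_wins_of_invariant G a Inv) => //.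
- by move=> D D' S sDD' inv v /inv sD; apply: subset_trans sDD'.
- move=> D S v inv /inv/subsetP sD; have [u vu] := Fcov v.
  by exists u; [apply: sD; rewrite inE | rewrite adj_sym Fadj].
- move=> D S v inv; rewrite !inE negb_or => /andP[vD vS].
  exists (nbrs F v); split=> //.
    apply/subsetP=> u; rewrite !inE negb_or => vu; apply/andP; split.
      (* If Staller owned the [F]-neighbour [u], the invariant at [u] would have put [v] in [D]. *)
      apply: contra vD => /inv/subsetP; apply; rewrite inE; exact: Fsym.
    by apply/eqP=> uv; have := Fadj _ _ vu; rewrite uv adj_irr.
  move=> u; rewrite !inE => /orP[/inv sD|/eqP ->]; last exact: subsetUr.
  exact: subset_trans sD (subsetUl _ _).
- by move=> v; rewrite inE.
Qed.

(** Descent on [#|F|] from the set of all edges of [G]: as long as some degree is at least [k], a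
    swap of two edges for one gives a smaller cover. *)
Lemma edge_cover_bounded_degree (G : sgraph) (k : nat) :
    2 < k -> induced_free (star k) G -> 0 < min_degree G ->
  exists2 F : {set G * G}, edge_cover F & forall v, #|nbrs F v| <= k.-1.
Proof.
move=> k_gt2 free dG; pose F0 := [set p : G * G | adj p.1 p.2].
have : edge_cover F0.
  split=> [x y|x y|v]; rewrite ?inE //= 1?adj_sym //.
  by have [u vu] := has_neighbour v dG; exists u; rewrite inE.
have [n] := ubnP #|F0|; elim: n (F0) => // n IH {F0}F ltn [Fadj Fsym Fcov].
have [/forallP|/forallPn[v]] := boolP [forall v, #|nbrs F v| <= k.-1].
  by exists F.
rewrite -ltnNge prednK ?(ltn_trans _ k_gt2) // => degv.
have sN : nbrs F v \subset [set u | adj v u].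
  by apply/subsetP=> u; rewrite !inE => /Fadj.
have [x [y [xN yN xy adjxy]]] := induced_star_free_adj free sN degv.
have [vx vy] : (v, x) \in F /\ (v, y) \in F by move: xN yN; rewrite !inE.
have xv : x != v by apply: contraTneq (Fadj _ _ vx) => ->; rewrite adj_irr.
have yv : y != v by apply: contraTneq (Fadj _ _ vy) => ->; rewrite adj_irr.
pose old := [set (v, x); (x, v); (v, y); (y, v)].
pose new := [set (x, y); (y, x)].
have card_old : #|old| = 4.
  rewrite /old -!setUA !cardsU1 cards1 !inE !xpair_eqE !eqxx.
  by rewrite (negPf xv) (negPf yv) (negPf xy) [v == x]eq_sym [v == y]eq_sym
             (negPf xv) (negPf yv).
have sold : old \subset F.
  apply/subsetP=> p; rewrite !inE.
  by case/orP=> [/orP[/orP[]|]|] /eqP -> //; apply: Fsym.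
(* Four ordered pairs are removed and at most two are added. *)
apply: (IH (F :\: old :|: new)).
  rewrite -ltnS; apply: leq_trans ltn; rewrite ltnS.
  apply: leq_ltn_trans (_ : #|F| - 4 + 2 < _).
    apply: leq_trans (leq_card_setU _ _) _.
    by rewrite cardsD (setIidPr sold) card_old leq_add2l cards2; case: eqP.
  have : 4 <= #|F| by rewrite -card_old subset_leq_card.
  by move/subnK=> {2}<-; rewrite ltn_add2l.
split=> [z t|z t|z].
- rewrite !inE => /orP[/andP[_ /Fadj] //|].
  by case/orP=> /eqP[-> ->] //; rewrite adj_sym.
- have oldC : ((t, z) \in old) = ((z, t) \in old).
    by rewrite !inE !xpair_eqE; do !case: (_ == _).
  have newC : ((t, z) \in new) = ((z, t) \in new).
    by rewrite !inE !xpair_eqE; do !case: (_ == _).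
  rewrite ![_ \in _ :|: new]in_setU ![_ \in F :\: _]in_setD oldC newC.
  case/orP=> [/andP[-> /Fsym ->] //|->].
  by rewrite orbT.
(* No vertex becomes isolated: [v] has at least [k > 2] neighbours, so one other than [x] and [y]
   remains; [x] and [y] now cover each other; all other vertices keep their edges. *)
have [->|zv] := eqVneq z v.
  have /card_gt0P[u] : 0 < #|nbrs F v :\: [set x; y]|.
    rewrite cardsD subn_gt0; apply: leq_ltn_trans (leq_trans k_gt2 degv).
    apply: leq_trans (subset_leq_card (subsetIr _ _)) _.
    by rewrite cards2; case: eqP.
  rewrite !inE negb_or => /andP[/andP[ux uy] vu].
  exists u; rewrite !inE vu !xpair_eqE !eqxx (negPf ux) (negPf uy).
  by rewrite ![v == _]eq_sym (negPf xv) (negPf yv).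
have [->|zx] := eqVneq z x; first by exists y; rewrite !inE eqxx !orbT.
have [->|zy] := eqVneq z y; first by exists x; rewrite !inE eqxx !orbT.
have [u zu] := Fcov z; exists u; rewrite !inE zu !xpair_eqE.
by rewrite (negPf zv) (negPf zx) (negPf zy).
Qed.

(** Without an induced [K_{1,2}], adjacency is transitive on distinct vertices, so one Dominator
    vertex in a clique is adjacent to every Staller vertex there. *)
Lemma dom_wins_star2_free (G : sgraph) :
    induced_free (star 2) G -> 0 < min_degree G -> dom_wins_Sgame G 1 1.
Proof.
move=> free dG.
have trans (x y z : G) : adj y x -> adj y z -> x != z -> adj x z.
  move=> yx yz xz.
  have [||s [t []]] := @induced_star_free_adj G 2 y [set x; z] free.
  - by apply/subsetP=> u; rewrite !inE => /orP[] /eqP ->.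
  - by rewrite cards2 xz.
  rewrite !inE => /orP[] /eqP -> /orP[] /eqP ->; rewrite ?eqxx //.
  by rewrite adj_sym.
pose Inv (D S : {set G}) :=
  forall v, v \in S -> exists2 u, u \in D & adj u v.
apply: (@dom_wins_of_invariant G 1 Inv) => //.
- move=> D D' S /subsetP sDD' inv v /inv[u uD uv].
  by exists u => //; apply: sDD'.
- by move=> D S v inv /inv.
- move=> D S v inv; rewrite !inE negb_or => /andP[vD vS].
  have [w vw] := has_neighbour v dG.
  have invU R : (exists2 u, u \in D :|: R & adj u v) ->
      Inv (D :|: R) (S :|: [set v]).
    move=> nbr_v u; rewrite !inE => /orP[/inv[t tD tu]|/eqP -> //].
    by exists t => //; rewrite inE tD.
  have [wS|wS] := boolP (w \in S).
    exists set0; rewrite cards0 sub0set; split=> //; apply: invU.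
    have [u uD uw] := inv w wS; exists u; first by rewrite inE uD.
    apply: (trans _ w); rewrite 1?adj_sym //.
    by apply: contraNneq vD => <-.
  exists [set w]; rewrite cards1; split=> //.
    rewrite sub1set !inE (negPf wS) /=.
    by apply: contraTneq vw => ->; rewrite adj_irr.
  by apply: invU; exists w; rewrite ?inE ?eqxx ?orbT // adj_sym.
- by move=> v; rewrite inE.
Qed.

(** Any edge is an induced [K_{1,1}]. This settles [k = 1], where the bound [k - 1 = 0] is not a
    legitimate bias: the hypotheses contradict each other. *)
Lemma star1_free_min_degree (G : sgraph) :
  induced_free (star 1) G -> min_degree G = 0.
Proof.
move=> free; apply/eqP; rewrite eqn0Ngt; apply/negP=> dG.
have /card_gt0P[v _] := vert_gt0 G; have [u vu] := has_neighbour v dG.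
have [||x [y []]] := @induced_star_free_adj G 1 v [set u] free.
- by rewrite sub1set inE.
- by rewrite cards1.
by rewrite !inE => /eqP -> /eqP ->; rewrite eqxx.
Qed.

Theorem corollary9 :
  (forall (k : nat) (G : sgraph),
     0 < k -> induced_free (star k) G -> 1 <= min_degree G ->
     enat_le (Sgame_threshold 1 G) (Some (k - 1)))
  /\
  (forall G : sgraph,
     claw_free G -> 1 <= min_degree G ->
     enat_le (Sgame_threshold 1 G) (Some 2)).
Proof.
have main (k : nat) (G : sgraph) :
    0 < k -> induced_free (star k) G -> 1 <= min_degree G ->
    enat_le (Sgame_threshold 1 G) (Some (k - 1)).
  case: k => [|[|[|k]]] // _ free dG.
  - by rewrite star1_free_min_degree in dG.
  - by apply: Sgame_threshold_le => //; apply: dom_wins_star2_free.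
  have [F coverF degF] := edge_cover_bounded_degree (isT : 2 < k.+3) free dG.
  rewrite subn1; apply: Sgame_threshold_le => //.
  exact: dom_wins_of_edge_cover degF _.
by split=> // G; apply: (main 3).
Qed.
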